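(* For every constant $\varepsilon>0$ there exists $n_0$ such that for every $n\ge n_0$, every closed knight's tour on the $n\times n$ board has at least $(6-\varepsilon)n$ turns.
   Context: The $n\times n$ board consists of the cells $(i,j)$ with $i,j\in\{0,\dots,n-1\}$ ($i$ the row, $j$ the column), each identified with the point $(i,j)$ of the plane. Two cells are a knight move apart if their coordinates differ by $1$ in one coordinate and by $2$ in the other. A closed knight's tour is a cyclic sequence $c_0,c_1,\dots,c_{n^2-1}$ listing every cell exactly once such that consecutive cells (including $c_{n^2-1},c_0$) are a knight move apart, i.e. a Hamiltonian cycle in the knight-move graph. A turn is a triple of cyclically consecutive cells $c_{k-1},c_k,c_{k+1}$ of the tour whose coordinates are not collinear; the number of turns of the tour is the number of indices $k$ for which this happens. *)

(* Defs.v *)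
From HB Require Import structures.
From mathcomp Require Import all_boot all_order all_algebra.
From mathcomp Require Import reals.

Set Implicit Arguments.
Unset Strict Implicit.
Unset Printing Implicit Defensive.

Import Order.TTheory GRing.Theory Num.Theory.

Local Open Scope ring_scope.

Definition cell (n : nat) : Type := 'I_n * 'I_n.

Definition cell_row (n : nat) (p : cell n) : int := (nat_of_ord p.1)%:Z.

Definition cell_col (n : nat) (p : cell n) : int := (nat_of_ord p.2)%:Z.

Definition knight_move (n : nat) (p q : cell n) : bool :=
  let dr := `|cell_row p - cell_row q| in
  let dc := `|cell_col p - cell_col q| in
  ((dr == 1) && (dc == 2)) || ((dr == 2) && (dc == 1)).

(* The vectors q - p and r - p are linearly dependent. *)
Definition collinear (n : nat) (p q r : cell n) : bool :=
  (cell_row q - cell_row p) * (cell_col r - cell_col p)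
    == (cell_col q - cell_col p) * (cell_row r - cell_row p).

(* [ordS] and [ord_pred] are the cyclic successor and predecessor on 'I_m. *)
Definition closed_knight_tour (n : nat) (c : 'I_(n ^ 2)%N -> cell n) : Prop :=
  bijective c /\ forall k, knight_move (c k) (c (ordS k)).

Definition num_turns (n : nat) (c : 'I_(n ^ 2)%N -> cell n) : nat :=
  #|[set k | ~~ collinear (c (ord_pred k)) (c k) (c (ordS k))]|.

(* Main.v *)
Require Import Defs.
From HB Require Import structures.
From mathcomp Require Import all_boot all_order all_algebra.
From mathcomp Require Import reals.
From mathcomp Require Import zify lra.

Import Order.TTheory GRing.Theory Num.Theory.

Local Open Scope ring_scope.

(** Every cell of the border is a turn, which gives about [4 n] turns. Two legs
    leaving the same side in converging directions meet in a common cell as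
    soon as their starting points are at a distance divisible by 60, and a cell
    passed straight by two different legs is impossible. So among the border
    cells of one side within a window of length [W] and in one residue class
    mod 60, those whose two legs both go straight for [W] moves have strictly
    increasing slopes, and there are at most 5 of them. Hence, up to [O(n / W)]
    exceptions, every border cell has a leg that ends after at most [W] moves;
    away from the corners it ends at a turn inside the board. A turn ends two
    legs, so there are about [4 n / 2] further turns. *)

(** * Knight vectors and rays leaving a side *)

Definition knight_vector (a b : int) : bool :=
  ((`|a| == 1) && (`|b| == 2)) || ((`|a| == 2) && (`|b| == 1)).

Lemma knight_vector_inward (a b : int) : knight_vector a b -> 0 <= b ->
  [\/ a = -2 /\ b = 1, a = -1 /\ b = 2, a = 1 /\ b = 2 | a = 2 /\ b = 1].
Proof.
rewrite /knight_vector => ab b_ge0.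
have : (a = -2 /\ b = 1) \/ (a = -1 /\ b = 2) \/ (a = 1 /\ b = 2) \/
  (a = 2 /\ b = 1) by lia.
by case=> [?|[?|[?|?]]];
  [constructor 1 | constructor 2 | constructor 3 | constructor 4].
Qed.

(** The hypothesis, shaped after [collinear], reduces to [a * b' = b * a']. A knight vector has
    coprime entries, so parallel ones agree up to sign. *)
Lemma knight_vector_parallel (a b a' b' : int) :
  knight_vector a b -> knight_vector a' b' -> a * (b + b') = b * (a + a') ->
  (a' = a /\ b' = b) \/ (a' = - a /\ b' = - b).
Proof.
rewrite /knight_vector => ab ab'.
have : a = 1 \/ a = -1 \/ a = 2 \/ a = -2 by lia.
have : b = 1 \/ b = -1 \/ b = 2 \/ b = -2 by lia.
by move=> [?|[?|[?|?]]] [?|[?|[?|?]]]; subst a b; lia.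
Qed.

(* 60 is the least common multiple of the distances 2, 3, 4, 5 at which two
   converging rays from the same side first meet in a cell. *)
Lemma inward_rays_meet (a b a' b' : int) (t : nat) :
  knight_vector a b -> knight_vector a' b' -> 0 <= b -> 0 <= b' -> a' < a ->
  (0 < t)%N ->
  exists i i' : nat, [/\ (0 < i <= 60 * t)%N, (0 < i' <= 60 * t)%N,
    i%:Z * a = (60 * t)%N%:Z + i'%:Z * a' & i%:Z * b = i'%:Z * b'].
Proof.
move=> ab ab' b0 b0' lt_a t_gt0.
case: (knight_vector_inward _ _ ab b0) => -[? ?];
case: (knight_vector_inward _ _ ab' b0') => -[? ?]; subst a b a' b';
  try by exfalso; lia.
- by exists (20 * t)%N, (40 * t)%N; split; lia.
- by exists (12 * t)%N, (24 * t)%N; split; lia.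
- by exists (30 * t)%N, (30 * t)%N; split; lia.
- by exists (15 * t)%N, (15 * t)%N; split; lia.
- by exists (24 * t)%N, (12 * t)%N; split; lia.
- by exists (40 * t)%N, (20 * t)%N; split; lia.
Qed.

(** * Straight legs in a half-plane *)

Section HalfPlane.

Variables (I : finType) (next : bool -> I -> I) (X Y : I -> int).

Hypothesis XY_inj : forall k l, X k = X l -> Y k = Y l -> k = l.
Hypothesis Y_ge0 : forall k, 0 <= Y k.
Hypothesis next_knight : forall s k,
  knight_vector (X (next s k) - X k) (Y (next s k) - Y k).
Hypothesis nextK : forall s, cancel (next s) (next (~~ s)).

Definition straight k : bool :=
  (X (next true k) + X (next false k) == 2 * X k) &&
  (Y (next true k) + Y (next false k) == 2 * Y k).

Lemma straight_next s k : straight k ->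
  X (next s k) = 2 * X k - X (next (~~ s) k) /\
  Y (next s k) = 2 * Y k - Y (next (~~ s) k).
Proof. by rewrite /straight; case: s => /=; lia. Qed.

(** The start is excluded because legs start at border cells, which are turns. *)
Definition straight_run s W k : Prop :=
  forall i, (0 < i <= W)%N -> straight (iter i (next s) k).

(** Two consecutive positions are carried along: the induction needs both, and the second reaches
    the cell just after the run. *)
Lemma straight_run_coord s W k i : straight_run s W k -> (i <= W)%N ->
  X (iter i (next s) k) = X k + i%:Z * (X (next s k) - X k) /\
  Y (iter i (next s) k) = Y k + i%:Z * (Y (next s k) - Y k) /\
  X (iter i.+1 (next s) k) = X k + i.+1%:Z * (X (next s k) - X k) /\
  Y (iter i.+1 (next s) k) = Y k + i.+1%:Z * (Y (next s k) - Y k).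
Proof.
move=> run; elim: i => [|i IH] le_i; first by rewrite /=; lia.
have [IH1 [IH2 [IH3 IH4]]] := IH (ltnW le_i).
have /(straight_next s) : straight (iter i.+1 (next s) k) by apply: run; lia.
have -> : next (~~ s) (iter i.+1 (next s) k) = iter i (next s) k.
  exact: nextK.
rewrite -!iterS.
lia.
Qed.

Lemma bottom_not_straight k : Y k = 0 -> ~~ straight k.
Proof.
move=> Yk; apply/negP => /(straight_next true) /= [_ eqY].
have := next_knight true k; have := next_knight false k.
have := Y_ge0 (next true k); have := Y_ge0 (next false k).
rewrite /knight_vector; lia.
Qed.

Lemma straight_runs_do_not_cross s s' W t k k' : Y k = 0 -> Y k' = 0 ->
  straight_run s W k -> straight_run s' W k' ->
  (0 < t)%N -> (60 * t <= W)%N -> X k' = X k + (60 * t)%N%:Z ->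
  X (next s k) - X k <= X (next s' k') - X k'.
Proof.
move=> Yk Yk' run run' t_gt0 le_tW eqX; rewrite leNgt; apply/negP => lt_a.
have ab := next_knight s k; have ab' := next_knight s' k'.
have b_ge0 : 0 <= Y (next s k) - Y k by have := Y_ge0 (next s k); lia.
have b_ge0' : 0 <= Y (next s' k') - Y k' by have := Y_ge0 (next s' k'); lia.
have [i [i' [hi hi' eqa eqb]]] :=
  inward_rays_meet _ _ _ _ _ ab ab' b_ge0 b_ge0' lt_a t_gt0.
have [|] := straight_run_coord _ _ _ i run; first by lia.
have [|] := straight_run_coord _ _ _ i' run'; first by lia.
rewrite !iterS => hX' [hY' [hX1' hY1']] hX [hY [hX1 hY1]].
have eq_q : iter i (next s) k = iter i' (next s') k' by apply: XY_inj; lia.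
have : straight (iter i (next s) k) by apply: run; lia.
rewrite eq_q in hX hY hX1 hY1 *.
move: (iter i' _ _) hX hY hX1 hY1 hX' hY' hX1' hY1' => q.
move=> hX hY hX1 hY1 hX' hY' hX1' hY1' /(straight_next s).
(* Both legs pass straight through [q]. Followed in the same sense they have equal directions,
   against [lt_a]; in opposite senses, opposite directions, though both point inward. *)
have [eq_s|neq_s] := eqVneq s' s.
  by rewrite eq_s in hX1' hY1'; lia.
have -> : ~~ s = s' by case: (s) (s') neq_s => [] [].
move: ab ab'; rewrite /knight_vector; lia.
Qed.

Definition max_slope k : int :=
  Num.max (X (next true k) - X k) (X (next false k) - X k).

Lemma max_slope_le k : `|max_slope k| <= 2.
Proof.
have := next_knight true k; have := next_knight false k.
by rewrite /max_slope /knight_vector; lia.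
Qed.

(** Neither leg of [k] exceeds either leg of [k'], and the legs of [k'] have distinct slopes; taking
    the maximum thus makes the inequality strict. *)
Lemma max_slope_lt W t k k' : next true k' <> next false k' ->
  Y k = 0 -> Y k' = 0 ->
  (forall s, straight_run s W k) -> (forall s, straight_run s W k') ->
  (0 < t)%N -> (60 * t <= W)%N -> X k' = X k + (60 * t)%N%:Z ->
  max_slope k < max_slope k'.
Proof.
move=> neq Yk Yk' run run' t_gt0 le_t eqX.
have cmp s s' := straight_runs_do_not_cross s s' W t k k' Yk Yk'
  (run s) (run' s') t_gt0 le_t eqX.
have := cmp true true; have := cmp true false.
have := cmp false true; have := cmp false false.
suff : X (next true k') - X k' <> X (next false k') - X k'.
  by rewrite /max_slope; lia.
(* The horizontal part of an inward knight vector determines its vertical part. *)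
move=> eqX'; apply: neq; apply: XY_inj; first by lia.
have := next_knight true k'; have := next_knight false k'.
have := Y_ge0 (next true k'); have := Y_ge0 (next false k').
by rewrite /knight_vector; lia.
Qed.

End HalfPlane.

(** * First hitting times of an injective map *)

Section FirstHit.

Variables (T : Type) (f : T -> T) (P : pred T) (W : nat).
Hypothesis f_inj : injective f.

Definition hits k := has (fun i => P (iter i.+1 f k)) (iota 0 W).

(** Without a hit the value is [W.+1]. *)
Definition first_hit k := (find (fun i => P (iter i.+1 f k)) (iota 0 W)).+1.

Lemma first_hit_le k : hits k -> (first_hit k <= W)%N.
Proof. by rewrite /hits has_find size_iota. Qed.

Lemma first_hitP k : hits k -> P (iter (first_hit k) f k).
Proof.
move=> hk; have := nth_find 0 hk.
by rewrite nth_iota ?add0n //; exact: first_hit_le.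
Qed.

Lemma before_first_hit k i : (0 < i < first_hit k)%N -> (i <= W)%N ->
  ~~ P (iter i f k).
Proof.
case: i => // i /=; rewrite ltnS => lt_i le_i.
by have := before_find 0 lt_i; rewrite nth_iota // add0n /= => ->.
Qed.

Lemma no_hit k i : ~~ hits k -> (0 < i <= W)%N -> ~~ P (iter i f k).
Proof.
case: i => // i /hasPn no_hit /= lt_i.
by apply: no_hit; rewrite mem_iota.
Qed.

(** Cancelling the shorter walk puts one start on the other's walk; unless they coincide, that start
    is an earlier hit. *)
Lemma first_hit_inj k k' : P k -> P k' -> hits k -> hits k' ->
  iter (first_hit k) f k = iter (first_hit k') f k' -> k = k'.
Proof.
wlog le_kk' : k k' / (first_hit k <= first_hit k')%N => [hwlog|] Pk Pk' hk hk'.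
  case: (leqP (first_hit k) (first_hit k')) => [|/ltnW] le_kk' eq_kk'.
    exact: hwlog.
  by apply/esym; apply: hwlog.
have iter_inj i : injective (iter i f).
  by elim: i => [|i IH] x y //= /f_inj /IH.
rewrite -(subnKC le_kk') iterD => /iter_inj eq_k.
case: (posnP (first_hit k' - first_hit k)) eq_k => [-> //|d_gt0 eq_k].
have := before_first_hit k' (first_hit k' - first_hit k).
rewrite -eq_k Pk; have := first_hit_le _ hk'.
by rewrite /first_hit in d_gt0 *; move=> ? /(_ _ _) H; exfalso; apply/negP/H; lia.
Qed.

End FirstHit.

(** * The tour in coordinates placing each side on [side_y = 0] *)

Section Tour.

Variables (n : nat) (c : 'I_(n ^ 2)%N -> cell n).
Hypothesis tour_c : closed_knight_tour c.

Definition step (s : bool) : 'I_(n ^ 2)%N -> 'I_(n ^ 2)%N :=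
  if s then @ordS _ else @ord_pred _.

Lemma stepK s : cancel (step s) (step (~~ s)).
Proof. by case: s; [exact: ordSK | exact: ord_predK]. Qed.

(* The first boolean selects the columns (rather than the rows) at the border,
   the second the far border (rather than the one at 0). *)
Definition side_x (o : bool * bool) k : int :=
  if o.1 then cell_row (c k) else cell_col (c k).

Definition side_y (o : bool * bool) k : int :=
  let z := if o.1 then cell_col (c k) else cell_row (c k) in
  if o.2 then n%:Z - 1 - z else z.

Lemma side_bounds o k : 0 <= side_x o k < n%:Z /\ 0 <= side_y o k < n%:Z.
Proof.
rewrite /side_x /side_y /cell_row /cell_col.
have := ltn_ord (c k).1; have := ltn_ord (c k).2.
by case: o => [[] []] /=; lia.
Qed.

Lemma side_inj o k l : side_x o k = side_x o l -> side_y o k = side_y o l ->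
  k = l.
Proof.
move=> eqx eqy; apply: (bij_inj tour_c.1).
rewrite [c k]surjective_pairing [c l]surjective_pairing.
move: eqx eqy; rewrite /side_x /side_y /cell_row /cell_col.
by case: o => [[] []] /= eqx eqy; congr pair; apply: val_inj => /=; lia.
Qed.

Lemma side_knight o s k :
  knight_vector (side_x o (step s k) - side_x o k)
                (side_y o (step s k) - side_y o k).
Proof.
have : knight_move (c k) (c (step s k)).
  case: s => /=; first exact: tour_c.2.
  have := tour_c.2 (ord_pred k); rewrite ord_predK /knight_move; lia.
rewrite /knight_move /knight_vector /side_x /side_y.
by case: o => [[] []] /=; lia.
Qed.

Lemma side_surj o (x : nat) : (x < n)%N ->
  exists k, side_x o k = x%:Z /\ side_y o k = 0.
Proof.
case: o => s t lt_x.
have [y lt_y eq_y] : exists2 y, (y < n)%N & y = if t then n.-1 else 0%N.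
  by eexists; last reflexivity; case: t; lia.
have [d _ dK] := tour_c.1.
pose i := Ordinal lt_x; pose j := Ordinal lt_y.
exists (d (if s then (i, j) else (j, i))).
rewrite /side_x /side_y dK /cell_row /cell_col.
by case: s; case: t eq_y => /= ->; lia.
Qed.

Definition tour_straight o := straight _ step (side_x o) (side_y o).

(** Midpoints survive swapping and reflecting coordinates, so all four sides share one set of
    turns. *)
Lemma tour_straight_side o o' k : tour_straight o k = tour_straight o' k.
Proof.
rewrite /tour_straight /straight /side_x /side_y.
by case: o => [[] []]; case: o' => [[] []] /=; lia.
Qed.

Hypothesis n_gt1 : (1 < n)%N.

Lemma ordS_neq_pred (k : 'I_(n ^ 2)%N) : ordS k <> ord_pred k.
Proof.
move/(congr1 val) => /=; have := ltn_ord k.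
have : (4 <= n ^ 2)%N by rewrite (@leq_sqr 2).
move: (nat_of_ord k) => i; move: (n ^ 2)%N => N le_N lt_i.
have [->|i_gt0] := posnP i.
  by rewrite add0n !modn_small; lia.
have -> : ((i + N).-1 = i.-1 + N)%N by lia.
rewrite modnDr [(i.-1 %% _)%N]modn_small; last by lia.
have [lt_iN|ge_iN] := ltnP i.+1 N; first by rewrite modn_small; lia.
have -> : i.+1 = N by lia.
by rewrite modnn; lia.
Qed.

(** Collinear consecutive moves are equal or opposite; opposite ones would return to the previous
    cell, which a cycle of length at least 4 forbids. *)
Lemma collinear_straight o k :
  collinear (c (ord_pred k)) (c k) (c (ordS k)) -> tour_straight o k.
Proof.
rewrite (tour_straight_side o (true, false)) => /eqP col.
have kn := side_knight (true, false) true k.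
have kp := side_knight (true, false) false k.
have neq : c (ordS k) <> c (ord_pred k).
  by move/(bij_inj tour_c.1); exact: ordS_neq_pred.
rewrite /tour_straight /straight /side_x /side_y /= in kn kp *.
set a := cell_row (c k) - cell_row (c (ord_pred k)) in col.
set b := cell_col (c k) - cell_col (c (ord_pred k)) in col.
have kp' : knight_vector a b by move: kp; rewrite /knight_vector; lia.
have := knight_vector_parallel _ _ _ _ kp' kn.
case=> [|[]|[eqa eqb]]; rewrite /a /b in col *; try lia.
case: neq; rewrite [c (ordS k)]surjective_pairing.
rewrite [c (ord_pred k)]surjective_pairing.
move: eqa eqb; rewrite /a /b /cell_row /cell_col => eqa eqb.
by congr pair; apply: val_inj => /=; lia.
Qed.

(** * Counting border turns and leg ends *)

Section BoundaryCount.

Variables (W m : nat).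
Hypothesis W_gt0 : (0 < W)%N.
Hypothesis n_eq : n = (m + (4 * W + 2))%N.

(* The cells of the four sides at distance more than [2 * W] from the corners;
   [W] straight moves starting there stay away from the other sides. *)
Variable bd : bool * bool * 'I_m -> 'I_(n ^ 2)%N.
Hypothesis bd_x : forall e, side_x e.1 (bd e) = (2 * W + 1 + e.2)%N%:Z.
Hypothesis bd_y : forall e, side_y e.1 (bd e) = 0.

Definition tour_turn k : bool := ~~ tour_straight (false, false) k.

Lemma bd_turn e : tour_turn (bd e).
Proof.
rewrite /tour_turn (tour_straight_side _ e.1).
apply: bottom_not_straight (bd_y e) => [k|s k]; last exact: side_knight.
by have [_ /andP[]] := side_bounds e.1 k.
Qed.

Lemma bd_inj : injective bd.
Proof.
move=> [[s t] i] [[s' t'] i'] eq_bd.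
have := bd_x (s, t, i); have := bd_y (s, t, i).
have := bd_x (s', t', i'); have := bd_y (s', t', i').
have := ltn_ord i; have := ltn_ord i'.
rewrite {}eq_bd /side_x /side_y /= => lt_i' lt_i y' x' y x.
have [eq_s eq_t] : s = s' /\ t = t'.
  by case: s s' t t' y y' x x' => [] [] [] [] /=; lia.
subst s t; congr (_, _); apply: val_inj => /=.
by case: s' x x' y y' => /=; lia.
Qed.

Definition leg_end s e :=
  iter (first_hit _ (step s) tour_turn W (bd e)) (step s) (bd e).

Definition short_leg s := [set e | hits _ (step s) tour_turn W (bd e)].

(** At most [W] moves in a fixed direction shift each coordinate by at most [2 * W], too little to
    reach another side, and the leg never returns to its own. *)
Lemma leg_end_interior s e : e \in short_leg s ->
  leg_end s e \notin bd @: setT.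
Proof.
rewrite inE => hit; apply/imsetP => -[e' _].
(* The leg has [i] straight cells and the turn comes at move [i.+1]. *)
have [i eq_i] : exists i, first_hit _ (step s) tour_turn W (bd e) = i.+1.
  by eexists.
have le_i := first_hit_le _ _ _ _ _ hit.
have run : straight_run _ step (side_x e.1) (side_y e.1) s i (bd e).
  move=> l hl; rewrite -[straight _ _ _ _ _]/(tour_straight e.1 _).
  rewrite (tour_straight_side _ (false, false)) -[tour_straight _ _]negbK.
  by apply: (before_first_hit _ (step s) tour_turn W); lia.
have [_ [_ []]] := straight_run_coord _ _ _ _ stepK _ _ _ i run (leqnn i).
rewrite /leg_end eq_i; move: (iter i.+1 _ _) => q hx hy eq_q; subst q.
have kn := side_knight e.1 s (bd e).
have y_ge0 : 0 <= side_y e.1 (step s (bd e)).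
  by have [_ /andP[]] := side_bounds e.1 (step s (bd e)).
have x0 := bd_x e; have y0 := bd_y e; have y0' := bd_y e'.
rewrite x0 y0 subr0 in hx hy kn.
have lt_e := ltn_ord e.2; rewrite eq_i in le_i.
have {hx hy} [hx hy] : 0 < side_x e.1 (bd e') < n%:Z - 1 /\
    0 < side_y e.1 (bd e') < n%:Z - 1.
  rewrite hx hy.
  by case: (knight_vector_inward _ _ kn y_ge0) => -[-> ->];
    move: (nat_of_ord e.2) lt_e => j lt_j; lia.
move: hx hy y0'; rewrite /side_x /side_y.
by case: (e.1) => [[] []]; case: (e'.1) => [[] []] /=; lia.
Qed.

(** For fixed [s], [leg_end s] is injective into the turns outside [bd]. *)
Lemma card_short_leg s :
  (#|short_leg s| <= #|[set k | tour_turn k] :\: bd @: setT|)%N.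
Proof.
rewrite -(@card_in_imset _ _ (leg_end s)); last first.
  move=> e e'; rewrite !inE => he he' eq_end; apply: bd_inj.
  have step_inj : injective (step s) by apply: can_inj (stepK s).
  exact: (first_hit_inj _ _ _ _ step_inj _ _ (bd_turn e) (bd_turn e') he he').
apply/subset_leq_card/subsetP => _ /imsetP[e he ->].
rewrite !inE -[X in ~~ X && _]/(_ \in _) leg_end_interior //=.
by rewrite inE in he; apply: first_hitP he.
Qed.

Definition side_slope e := max_slope _ step (side_x e.1) (bd e).

Lemma side_slope_lt o i i' : (o, i) \notin short_leg true :|: short_leg false ->
  (o, i') \notin short_leg true :|: short_leg false ->
  (i < i')%N -> (i' < i + W)%N -> i = i' %[mod 60] ->
  side_slope (o, i) < side_slope (o, i').
Proof.
rewrite !inE !negb_or => /andP[h1 h0] /andP[h1' h0'] lt_i lt_iW eq_mod.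
have run e s : ~~ hits _ (step s) tour_turn W (bd e) ->
  straight_run _ step (side_x e.1) (side_y e.1) s W (bd e).
  move=> he l hl; rewrite -[straight _ _ _ _ _]/(tour_straight e.1 _).
  rewrite (tour_straight_side _ (false, false)) -[tour_straight _ _]negbK.
  exact: (no_hit _ (step s) tour_turn W).
have [t eq_t] : exists t, (i' = i + 60 * t :> nat)%N.
  exists ((i' - i) %/ 60)%N; lia.
apply: (max_slope_lt _ step (side_x o) (side_y o) _ _ _ _ W t) => //.
- exact: side_inj.
- by move=> k; have [_ /andP[]] := side_bounds o k.
- exact: side_knight.
- exact: stepK.
- exact: ordS_neq_pred.
- exact: (bd_y (o, i)).
- exact: (bd_y (o, i')).
- by case; exact: (run (o, i)).
- by case; exact: (run (o, i')).
- lia.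
- lia.
- by rewrite (bd_x (o, i)) (bd_x (o, i')) /=; lia.
Qed.

Lemma card_long_legs :
  (#|~: (short_leg true :|: short_leg false)| <= 1200 * (n %/ W).+1)%N.
Proof.
(* Side, window of length [W], residue mod 60 and slope shifted into 0..4: 4 * 60 * 5 = 1200 codes
   per window. Equal codes at distinct cells contradict [side_slope_lt]. *)
pose code (e : bool * bool * 'I_m) :
    bool * bool * 'I_(n %/ W).+1 * 'I_60 * 'I_5 :=
  (e.1, inord (e.2 %/ W), inord (e.2 %% 60), inord (absz (side_slope e + 2))).
have -> : (1200 * (n %/ W).+1 =
    #|{: bool * bool * 'I_(n %/ W).+1 * 'I_60 * 'I_5}|)%N.
  by rewrite !card_prod !card_bool !card_ord; lia.
apply: (leq_card_in code) => -[o i] [o' i']; rewrite !in_setC => hi hi'.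
case=> eq_o /(congr1 val) eq_div /(congr1 val) eq_mod /(congr1 val) eq_slope.
subst o'; congr (_, _); move: eq_div eq_mod eq_slope.
have div_lt (l : 'I_m) : (l %/ W < (n %/ W).+1)%N.
  by rewrite ltnS leq_div2r //; have := ltn_ord l; lia.
have slope_le e : `|side_slope e| <= 2.
  by apply: max_slope_le => s k; exact: side_knight.
have lt5 (x : int) : `|x| <= 2 -> (absz (x + 2)%R < 5)%N by lia.
have inj5 (x y : int) : `|x| <= 2 -> `|y| <= 2 ->
  absz (x + 2) = absz (y + 2) -> x = y by lia.
rewrite /= !inordK ?ltn_pmod ?lt5 // => eq_div eq_mod /inj5 eq_slope.
have {}eq_slope := eq_slope (slope_le _) (slope_le _).
have close (l l' : 'I_m) : (l %/ W = l' %/ W)%N -> (l' < l + W)%N.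
  move=> eq_l; rewrite (divn_eq l W) (divn_eq l' W) eq_l -addnA ltn_add2l.
  by rewrite ltn_addl ?ltn_pmod.
case: (ltngtP i i') => [lt_i|lt_i|/val_inj //].
  have := side_slope_lt _ _ _ hi hi' lt_i (close _ _ eq_div) eq_mod.
  by rewrite eq_slope ltxx.
have := side_slope_lt _ _ _ hi' hi lt_i (close _ _ (esym eq_div)) (esym eq_mod).
by rewrite eq_slope ltxx.
Qed.

(** With [L] cells having no short leg, the two directions give at least [4 * m - L] short legs,
    hence half as many further turns; doubling and adding the [4 * m] border turns gives
    [12 * m - L]. *)
Lemma count_turns :
  (12 * m <= 2 * num_turns c + 1200 * (n %/ W).+1)%N.
Proof.
set T := [set k | tour_turn k]; set B := bd @: setT.
have le_T : (#|T| <= num_turns c)%N.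
  apply/subset_leq_card/subsetP => k; rewrite !inE; apply: contra.
  exact: collinear_straight.
have sBT : B \subset T.
  by apply/subsetP => _ /imsetP[e _ ->]; rewrite inE bd_turn.
have cardE : #|{: bool * bool * 'I_m}| = (4 * m)%N.
  by rewrite !card_prod !card_bool card_ord.
have cardB : #|B| = (4 * m)%N by rewrite card_imset ?cardsT //; exact: bd_inj.
have := cardsID B T; rewrite (setIidPr sBT) cardB.
have := card_short_leg true; have := card_short_leg false.
rewrite -/T -/B; have := card_long_legs.
have := cardsC (short_leg true :|: short_leg false); rewrite cardE.
have [+ _] := leq_card_setU (short_leg true) (short_leg false).
by move: #|T :\: B| #|T| le_T => *; lia.
Qed.

End BoundaryCount.

End Tour.

(** * The asymptotic bound *)

Lemma num_turns_ge (n W : nat) (c : 'I_(n ^ 2)%N -> cell n) :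
  (0 < W)%N -> (4 * W + 2 <= n)%N -> closed_knight_tour c ->
  (12 * n <= 2 * num_turns c + 1200 * (n %/ W) + 48 * W + 1224)%N.
Proof.
move=> W_gt0 le_n tour_c; pose m := (n - (4 * W + 2))%N.
have n_eq : n = (m + (4 * W + 2))%N by rewrite /m; lia.
have [e|bd bdP] := @fin_all_exists (bool * bool * 'I_m)%type
  (fun=> 'I_(n ^ 2)%N)
  (fun e k => side_x n c e.1 k = (2 * W + 1 + e.2)%N%:Z /\ side_y n c e.1 k = 0).
  by apply: side_surj => //; have := ltn_ord e.2; lia.
have n_gt1 : (1 < n)%N by lia.
have := count_turns n c tour_c n_gt1 W m W_gt0 n_eq bd
  (fun e => (bdP e).1) (fun e => (bdP e).2).
by rewrite [in (12 * n)%N]n_eq; lia.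
Qed.

Theorem mainTheorem1 (R : realType) (eps : R) (eps_gt0 : 0 < eps) :
  exists n0 : nat, forall n : nat, (n0 <= n)%N ->
    forall c : 'I_(n ^ 2)%N -> cell n, closed_knight_tour c ->
      (6 - eps) * n%:R <= (num_turns c)%:R.
Proof.
(* [W] and [n0] make the window term and [C] each at most [eps * n]; halving leaves a loss of
   [eps * n]. The summand [C] in [n0] ensures [4 * W + 2 <= n]. *)
pose W := (Num.bound (1200 / eps)).+1.
pose C := (48 * W + 1224)%N.
exists (Num.bound (C%:R / eps) + C)%N => n le_n c tour_c.
have large_W : 1200 <= eps * W%:R.
  rewrite mulrC -ler_pdivrMr //; apply/ltW.
  apply: lt_trans (archi_boundP _) _; first by rewrite divr_ge0 ?ltW.
  by rewrite ltr_nat.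
have large_n : C%:R <= eps * n%:R.
  rewrite mulrC -ler_pdivrMr //; apply/ltW.
  apply: lt_le_trans (archi_boundP _) _; first by rewrite divr_ge0 ?ltW.
  by rewrite ler_nat; apply: leq_trans le_n; rewrite leq_addr.
have le_div : 1200 * (n %/ W)%:R <= eps * n%:R :> R.
  apply: (@le_trans _ _ (eps * W%:R * (n %/ W)%:R)); first by rewrite ler_wpM2r.
  rewrite -mulrA -natrM; apply: ler_wpM2l; first exact: ltW.
  by rewrite ler_nat mulnC leq_divM.
have : (12 * n <= 2 * num_turns c + 1200 * (n %/ W) + C)%N.
  by rewrite /C addnA; apply: num_turns_ge => //; apply: leq_trans le_n; rewrite /C; lia.
have cast (p q r s : nat) : (12 * p <= 2 * q + 1200 * r + s)%N ->
    12 * p%:R <= 2 * q%:R + 1200 * r%:R + s%:R :> R.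
  by rewrite -!natrM -!natrD ler_nat.
by move/cast; lra.
Qed.
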